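(* Let $A,B\in\mathbb{C}^{N\times N}$ be such that $A$ and $A+B$ are invertible, and define $W=I+A^{-1}B$. Then the smallest singular value $\sigma_{\min}$ and the largest singular value $\sigma_{\max}$ of $W$ satisfy $$\frac1{\sigma_{\min}}\le 1+\|(A+B)^{-1}\|\,\|B\|,\qquad \sigma_{\max}\le 1+\|A^{-1}\|\,\|B\|.$$ Hence the condition number $\kappa(W)$ satisfies $$\kappa(W)\le\bigl(1+\|(A+B)^{-1}\|\,\|B\|\bigr)\bigl(1+\|A^{-1}\|\,\|B\|\bigr).$$
   Context: $\|\cdot\|$ is the operator 2-norm and $\kappa(W)=\|W\|\,\|W^{-1}\|$. *)

(* Defs.v *)
From mathcomp Require Import all_boot all_order all_algebra.
From mathcomp Require Import complex.
From mathcomp Require Import boolp classical_sets reals.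

Set Implicit Arguments.
Unset Strict Implicit.
Unset Printing Implicit Defensive.

Import Order.TTheory GRing.Theory Num.Theory.
Import ComplexField.Normc.

Local Open Scope classical_set_scope.
Local Open Scope ring_scope.
Local Open Scope complex_scope.
Local Open Scope sesquilinear_scope.

Definition vnorm2 (R : realType) (n : nat) (x : 'cV[R[i]]_n) : R :=
  Num.sqrt (\sum_(i < n) normc (x i 0) ^+ 2).

Definition opnorm2 (R : realType) (m n : nat) (M : 'M[R[i]]_(m, n)) : R :=
  sup [set vnorm2 (M *m x) | x in [set x : 'cV[R[i]]_n | vnorm2 x <= 1]].

(* [invmx M] is the inverse only when [M \in unitmx] (otherwise it is [M]);
   the condition number is meant for invertible matrices. *)
Definition cond2 (R : realType) (n : nat) (M : 'M[R[i]]_n) : R :=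
  opnorm2 M * opnorm2 (invmx M).

(* The nonnegative square roots of the eigenvalues of [M^* M]; [eigenvalue] is
   stated with row vectors, which gives the same eigenvalues. *)
Definition singular_values (R : realType) (n : nat) (M : 'M[R[i]]_n) : set R :=
  [set s | 0 <= s /\ eigenvalue (M ^t* *m M) (s ^+ 2)%:C].

(* For [0 < n] the infimum and the supremum are attained: [sigma_minP] and
   [sigma_maxP] below. *)
Definition sigma_min (R : realType) (n : nat) (M : 'M[R[i]]_n) : R :=
  inf (singular_values M).

Definition sigma_max (R : realType) (n : nat) (M : 'M[R[i]]_n) : R :=
  sup (singular_values M).

Lemma eigenvalue_gram_ge0 (R : realType) (n : nat) (M : 'M[R[i]]_n) (a : R[i]) :
  eigenvalue (M ^t* *m M) a -> 0 <= a.
Proof.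
have sq (u : 'rV[R[i]]_n) : (u *m u ^t*) 0 0 = \sum_j `|u 0 j| ^+ 2.
  by rewrite mxE; apply: eq_bigr => j _; rewrite !mxE normCK.
have sq0 (u : 'rV[R[i]]_n) : 0 <= (u *m u ^t*) 0 0.
  by rewrite sq sumr_ge0 // => j _; rewrite exprn_ge0.
move=> /eigenvalueP[v vM vn0].
have /(congr1 (fun A : 'M[R[i]]_1 => A 0 0)) : (v *m M ^t*) *m (v *m M ^t*) ^t* = a *: (v *m v ^t*).
  by rewrite trmx_mul map_mxM trmxCK mulmxA -(mulmxA v) vM scalemxAl.
rewrite [RHS]mxE => E.
have vv : 0 < (v *m v ^t*) 0 0.
  rewrite lt0r sq0 andbT; apply: contra vn0 => /eqP; rewrite sq => /eqP.
  rewrite psumr_eq0 => [|j _]; last by rewrite exprn_ge0.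
  move=> /allP z; apply/eqP/rowP => j; rewrite mxE.
  have /= := z j (mem_index_enum j); by rewrite expf_eq0 /= normr_eq0 => /eqP.
by rewrite -(pmulr_lge0 _ vv) -E sq0.
Qed.

Lemma singular_values_seq (R : realType) (n : nat) (M : 'M[R[i]]_n) :
  (0 < n)%N -> exists2 s : seq R, s != [::] & singular_values M = [set` s].
Proof.
move=> n0; set G := M ^t* *m M.
have [rs ers] := closed_field_poly_normal (char_poly G).
have Pm : lead_coef (char_poly G) = 1 by apply/monicP/char_poly_monic.
have mrs a : eigenvalue G a = (a \in rs).
  by rewrite eigenvalue_root_char ers Pm scale1r root_prod_XsubC.
exists [seq Num.sqrt (complex.Re z) | z <- rs].
  have [a] := eigenvalue_closed G n0.
  by rewrite mrs; case: rs {ers mrs}.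
apply/seteqP; split=> x /=.
  move=> [x0]; rewrite mrs => xr; apply/mapP; exists ((x ^+ 2)%:C) => //=.
  by rewrite sqrtr_sqr ger0_norm.
move=> /mapP[z]; rewrite -mrs => ez ->; split; first exact: sqrtr_ge0.
have z0 := eigenvalue_gram_ge0 ez; have := z0; rewrite lecE => /andP[_ Rz0].
by rewrite sqr_sqrtr ?RRe_real ?ger0_real.
Qed.

Lemma seq_minP (R : realType) (s : seq R) :
  s != [::] -> exists2 m, m \in s & forall x, x \in s -> m <= x.
Proof.
elim: s => [//|y [|z s] IH _].
  by exists y => [|x]; rewrite inE // => /eqP->.
have [//|m ms mle] := IH.
have [ym|my] := leP y m.
  exists y => [|x]; rewrite inE ?eqxx // => /predU1P[->//|/mle].
  exact: le_trans.
exists m => [|x]; first by rewrite inE ms orbT.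
by rewrite inE => /predU1P[->|/mle//]; apply: ltW.
Qed.

Lemma sigma_minP (R : realType) (n : nat) (M : 'M[R[i]]_n) : (0 < n)%N ->
  singular_values M (sigma_min M) /\ lbound (singular_values M) (sigma_min M).
Proof.
move=> n0; rewrite /sigma_min; have [s s0 ->] := singular_values_seq M n0.
have [m ms mle] := seq_minP s0.
suff -> : inf [set` s] = m by split.
apply/eqP; rewrite eq_le ge_inf //=; last by exists m.
by apply: lb_le_inf => //; exists m.
Qed.

Lemma sigma_maxP (R : realType) (n : nat) (M : 'M[R[i]]_n) : (0 < n)%N ->
  singular_values M (sigma_max M) /\ ubound (singular_values M) (sigma_max M).
Proof.
move=> n0; rewrite /sigma_max; have [s s0 ->] := singular_values_seq M n0.
have s0' : [seq - x | x <- s] != [::] by case: s s0.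
have [_ /mapP[m ms ->] mle] := seq_minP s0'.
have lem x : x \in s -> x <= m.
  by move=> xs; rewrite -lerN2; apply: mle; apply: map_f.
suff -> : sup [set` s] = m by split.
apply/eqP; rewrite eq_le ub_le_sup ?andbT //; last by exists m.
by apply: ge_sup => //; exists m.
Qed.

Lemma sigma_min_gt0 (R : realType) (n : nat) (M : 'M[R[i]]_n) :
  (0 < n)%N -> M \in unitmx -> 0 < sigma_min M.
Proof.
move=> n0 uM; have [[s0 es] _] := sigma_minP M n0.
rewrite lt0r s0 andbT; apply: contraL es => /eqP->.
rewrite expr0n /=; apply/negP => /eigenvalueP[v]; rewrite scale0r => vM /negP[].
have uG : M ^t* *m M \in unitmx.
  by rewrite unitmx_mul uM map_unitmx unitmx_tr uM.
by rewrite -[v](mulmxK uG) vM mul0mx.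
Qed.

(* Main.v *)
Require Import Defs.
From mathcomp Require Import all_boot all_order all_algebra.
From mathcomp Require Import complex reals.
From mathcomp Require Import classical_sets.

Import Order.TTheory GRing.Theory Num.Theory.
Import ComplexField.Normc.
Local Open Scope ring_scope.
Local Open Scope complex_scope.

(** If [W^* W x = s^2 x] with [x <> 0] then [|W x| = s |x|], so each singular
    value [s] of [W] satisfies [s <= ||W||] and, when [W] is invertible,
    [1 <= ||W^-1|| s].  The bounds then follow from [W = I + A^-1 B] and
    [W^-1 = (A + B)^-1 A = I - (A + B)^-1 B]. *)

Section Norms.
Variable R : realType.
Local Open Scope sesquilinear_scope.

Lemma normc_ge0 (a : R[i]) : 0 <= normc a.
Proof. by case: a => ? ?; apply: sqrtr_ge0. Qed.

Lemma vnorm2_ge0 n (x : 'cV[R[i]]_n) : 0 <= vnorm2 x.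
Proof. exact: sqrtr_ge0. Qed.

Lemma sqr_vnorm2 n (x : 'cV[R[i]]_n) : (vnorm2 x ^+ 2)%:C = (x ^t* *m x) 0 0.
Proof.
rewrite sqr_sqrtr ?sumr_ge0 // => [|i _]; last exact: sqr_ge0.
rewrite rmorph_sum mxE; apply: eq_bigr => i _.
by rewrite !mxE [RHS]mulrC -normCK rmorphXn.
Qed.

(** Identifies [vnorm2] with the norm of the Hermitian form [dotmx], whose triangle inequality and
    definiteness then carry over. The form acts on row vectors, hence the conjugate transposes. *)
Lemma vnorm2_dotmx n (x : 'cV[R[i]]_n) :
  (vnorm2 x)%:C = sqrtC (dotmx (x ^t*) (x ^t*)).
Proof.
by rewrite dotmxE trmxCK -sqr_vnorm2 rmorphXn sqrCK // ler0c vnorm2_ge0.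
Qed.

Lemma vnorm2D n (x y : 'cV[R[i]]_n) : vnorm2 (x + y) <= vnorm2 x + vnorm2 y.
Proof.
rewrite -lecR rmorphD /= !vnorm2_dotmx linearD map_mxD.
by rewrite (triangle_lerif (@dotmx _ n)).
Qed.

Lemma vnorm2Z n (a : R[i]) (x : 'cV[R[i]]_n) :
  vnorm2 (a *: x) = normc a * vnorm2 x.
Proof.
rewrite -[X in X * _](ger0_norm (normc_ge0 _)) -sqrtr_sqr /vnorm2 -sqrtrM ?sqr_ge0 //.
congr Num.sqrt; rewrite mulr_sumr; apply: eq_bigr => i _.
by rewrite mxE normcM exprMn.
Qed.

Lemma vnorm2_0 n : vnorm2 (0 : 'cV[R[i]]_n) = 0.
Proof. by rewrite -(scale0r 0) vnorm2Z normc0 mul0r. Qed.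

Lemma vnorm2N n (x : 'cV[R[i]]_n) : vnorm2 (- x) = vnorm2 x.
Proof.
by rewrite -scaleN1r vnorm2Z normcN normc1 mul1r.
Qed.

Lemma vnorm2_eq0 n (x : 'cV[R[i]]_n) : (vnorm2 x == 0) = (x == 0).
Proof.
apply/eqP/eqP => [|->]; last exact: vnorm2_0.
move/(congr1 (real_complex R)); rewrite vnorm2_dotmx => /eqP.
rewrite sqrtC_eq0 (dnorm_eq0 (@dotmx _ n)) => /eqP x0.
by rewrite -[x]trmxCK x0 trmx0 map_mx0.
Qed.

Lemma normc_le_vnorm2 n (x : 'cV[R[i]]_n) i :
  normc (x i 0) <= vnorm2 x.
Proof.
rewrite -[leLHS](ger0_norm (normc_ge0 _)) -sqrtr_sqr ler_sqrt ?sumr_ge0 // => [|j _];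
  last exact: sqr_ge0.
by rewrite (bigD1 i) //= lerDl sumr_ge0 // => j _; apply: sqr_ge0.
Qed.

(** Expand [M *m x] over the columns of [M] and bound each coordinate of [x] by its norm. The
    constant is crude; only its finiteness matters, to bound the set whose [sup] is [opnorm2 M]. *)
Lemma vnorm2_mulmx_le m n (M : 'M[R[i]]_(m, n)) x :
  vnorm2 (M *m x) <= (\sum_j vnorm2 (col j M)) * vnorm2 x.
Proof.
have -> : M *m x = \sum_j x j 0 *: col j M.
  apply/colP => i; rewrite mxE summxE; apply: eq_bigr => j _.
  by rewrite !mxE mulrC.
rewrite mulr_suml; elim/big_ind2: _ => [|u a v b ua vb|j _].
- by rewrite vnorm2_0.
- exact: le_trans (vnorm2D _ _ _) (lerD ua vb).
by rewrite vnorm2Z mulrC ler_wpM2l ?vnorm2_ge0 ?normc_le_vnorm2.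
Qed.

Lemma opnorm2_has_sup m n (M : 'M[R[i]]_(m, n)) :
  has_sup [set vnorm2 (M *m x) | x in [set x : 'cV[R[i]]_n | vnorm2 x <= 1]].
Proof.
split; first by exists (vnorm2 (M *m 0)), 0; rewrite /= ?vnorm2_0.
exists (\sum_j vnorm2 (col j M)) => _ [x /= x1 <-].
apply: le_trans (vnorm2_mulmx_le _ _ _ _) _.
by rewrite ler_piMr // sumr_ge0 // => j _; apply: vnorm2_ge0.
Qed.

Lemma opnorm2_ge0 m n (M : 'M[R[i]]_(m, n)) : 0 <= opnorm2 M.
Proof.
apply: le_trans (vnorm2_ge0 m (M *m 0)) _.
apply: ub_le_sup; first by case: (opnorm2_has_sup _ _ M).
by exists 0; rewrite //= vnorm2_0.
Qed.

Lemma vnorm2_mulmx m n (M : 'M[R[i]]_(m, n)) x :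
  vnorm2 (M *m x) <= opnorm2 M * vnorm2 x.
Proof.
have [->|x0] := eqVneq x 0; first by rewrite mulmx0 !vnorm2_0 mulr0.
have nx0 : 0 < vnorm2 x by rewrite lt0r vnorm2_eq0 x0 vnorm2_ge0.
have nV : normc (vnorm2 x)^-1%:C = (vnorm2 x)^-1.
  (* Once embedded in [R[i]], [normc] is by conversion the norm there, which fixes nonnegative
     elements. *)
  apply: (@complexI R); rewrite -[LHS]/(`|(vnorm2 x)^-1%:C|).
  by rewrite ger0_norm // ler0c invr_ge0 ltW.
(* Rescale to the unit vector [x / |x|], whose image norm belongs to the set defining
   [opnorm2 M]. *)
rewrite -ler_pdivrMr // mulrC -nV -vnorm2Z scalemxAr.
apply: ub_le_sup; first by case: (opnorm2_has_sup _ _ M).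
by exists ((vnorm2 x)^-1%:C *: x); rewrite //= vnorm2Z nV mulVf ?gt_eqF.
Qed.

Lemma opnorm2_le m n (M : 'M[R[i]]_(m, n)) c : 0 <= c ->
  (forall x, vnorm2 (M *m x) <= c * vnorm2 x) -> opnorm2 M <= c.
Proof.
move=> c0 Mc; apply: ge_sup; first by case: (opnorm2_has_sup _ _ M).
by move=> _ [x /= x1 <-]; apply: le_trans (Mc x) _; rewrite ler_piMr.
Qed.

Lemma opnorm2_1D n (M : 'M[R[i]]_n) : opnorm2 (1%:M + M) <= 1 + opnorm2 M.
Proof.
apply: opnorm2_le => [|x]; first by rewrite addr_ge0 ?opnorm2_ge0.
rewrite mulmxDl mul1mx mulrDl mul1r.
by apply: le_trans (vnorm2D _ _ _) _; rewrite lerD2l vnorm2_mulmx.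
Qed.

Lemma opnorm2N m n (M : 'M[R[i]]_(m, n)) : opnorm2 (- M) <= opnorm2 M.
Proof.
apply: opnorm2_le => [|x]; first exact: opnorm2_ge0.
by rewrite mulNmx vnorm2N vnorm2_mulmx.
Qed.

Lemma opnorm2M m n p (M : 'M[R[i]]_(m, n)) (P : 'M_(n, p)) :
  opnorm2 (M *m P) <= opnorm2 M * opnorm2 P.
Proof.
apply: opnorm2_le => [|x]; first by rewrite mulr_ge0 ?opnorm2_ge0.
rewrite -mulmxA -mulrA; apply: le_trans (vnorm2_mulmx _ _ _ _) _.
by rewrite ler_wpM2l ?opnorm2_ge0 ?vnorm2_mulmx.
Qed.

(** A row eigenvector [v] of [M ^t* *m M] for [s ^+ 2] gives the column [x = v ^t*], and [|M x|^2 =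
    v M^* M v^* = s^2 v v^* = s^2 |x|^2]. *)
Lemma singular_vector n (M : 'M[R[i]]_n) s : singular_values M s ->
  exists2 x : 'cV[R[i]]_n, 0 < vnorm2 x & vnorm2 (M *m x) = s * vnorm2 x.
Proof.
case=> s0 /eigenvalueP[v vM vn0]; exists (v ^t*).
  rewrite lt0r vnorm2_ge0 vnorm2_eq0 andbT; apply: contra vn0 => /eqP v0.
  by rewrite -[v]trmxCK v0 trmx0 map_mx0.
(* Both sides are nonnegative, so it suffices to compare squares, inside [R[i]] where they are
   matrix products. *)
apply/eqP; rewrite -(@eqrXn2 _ 2) ?mulr_ge0 ?vnorm2_ge0 //; apply/eqP.
apply: (@complexI R); rewrite exprMn.
have CM (a b : R) : (a * b)%:C = a%:C * b%:C by exact: rmorphM.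
rewrite [RHS]CM !sqr_vnorm2 trmxCK.
rewrite trmx_mul map_mxM trmxCK mulmxA -(mulmxA v) vM -scalemxAl.
by rewrite mxE.
Qed.

Lemma singular_value_le_opnorm2 n (M : 'M[R[i]]_n) s :
  singular_values M s -> s <= opnorm2 M.
Proof.
case/singular_vector => x x0 Mx; rewrite -(ler_pM2r x0) -Mx.
exact: vnorm2_mulmx.
Qed.

Lemma singular_value_ge_opnorm2V n (M : 'M[R[i]]_n) s : M \in unitmx ->
  singular_values M s -> 1 <= opnorm2 (invmx M) * s.
Proof.
move=> uM /singular_vector[x x0 Mx]; rewrite -(ler_pM2r x0) mul1r -mulrA -Mx.
(* Only the [x] on the left becomes [invmx M *m (M *m x)]. *)
by rewrite -[in leLHS](mulKmx uM x) vnorm2_mulmx.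
Qed.

End Norms.

Theorem lemma11 (R : realType) (N : nat) (N_gt0 : (0 < N)%N)
    (A B : 'M[R[i]]_N)
    (A_unit : A \in unitmx) (AB_unit : A + B \in unitmx) :
  let W := 1%:M + invmx A *m B in
  [/\ 1 / sigma_min W <= 1 + opnorm2 (invmx (A + B)) * opnorm2 B,
      sigma_max W <= 1 + opnorm2 (invmx A) * opnorm2 B
    & cond2 W <= (1 + opnorm2 (invmx (A + B)) * opnorm2 B)
                 * (1 + opnorm2 (invmx A) * opnorm2 B)].
Proof.
move=> W.
have WE : W = invmx A *m (A + B) by rewrite mulmxDr mulVmx.
have uW : W \in unitmx by rewrite WE unitmx_mul unitmx_inv A_unit.
have WV : invmx W = 1%:M + - (invmx (A + B) *m B).
  (* Left multiplication by [W] is injective, and [W (I - (A+B)^-1 B) = W - A^-1 (A+B) (A+B)^-1 B =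
     W - A^-1 B = I]. *)
  apply: (can_inj (mulKmx uW)); rewrite mulmxV // mulmxDr mulmx1 mulmxN.
  by rewrite [in X in - X]WE mulmxA mulmxK // /W addrK.
have Wle : opnorm2 W <= 1 + opnorm2 (invmx A) * opnorm2 B.
  by apply: le_trans (opnorm2_1D _ _ _) _; rewrite lerD2l opnorm2M.
have WVle : opnorm2 (invmx W) <= 1 + opnorm2 (invmx (A + B)) * opnorm2 B.
  rewrite WV; apply: le_trans (opnorm2_1D _ _ _) _; rewrite lerD2l.
  exact: le_trans (opnorm2N _ _ _ _) (opnorm2M _ _ _ _ _ _).
split.
(* Since [W] is invertible, [sigma_min W] is positive and can be cleared from the denominator; being
   attained, it is itself a singular value. *)
- apply: le_trans _ WVle; rewrite ler_pdivrMr ?sigma_min_gt0 //.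
  apply: singular_value_ge_opnorm2V => //.
  by case: (sigma_minP W N_gt0).
- apply: le_trans _ Wle; apply: singular_value_le_opnorm2.
  by case: (sigma_maxP W N_gt0).
rewrite /cond2 [leLHS]mulrC.
exact: ler_pM (opnorm2_ge0 _ _ _ _) (opnorm2_ge0 _ _ _ _) WVle Wle.
Qed.
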